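(* Let $\ast$ be a binary operation on $I=[0,1]$ and let $\nabla$ be a t-conorm on $I$. Then the following statements are equivalent: (1) $\widetilde{\nabla}_{\ast}$ satisfies axiom (O5'), i.e. $\bm{1}_{[0,1]}\,\widetilde{\nabla}_{\ast}\,\bm{1}_{[a,b]}=\bm{1}_{[a,1]}$ for all $0\le a\le b\le 1$; (2) $1\ast 0=0$, $1\ast 1=1$, and the function $I\to I$, $x\mapsto x\nabla b$, is continuous for all $b\in I$; (3) $1\ast 0=0$, $1\ast 1=1$, and $\nabla$ is a continuous t-conorm.
   Context: Let $I=[0,1]$ and let $\mathbf{M}$ be the set of all maps $I\to I$. For $B\subseteq I$, $\bm{1}_B\in\mathbf{M}$ is the characteristic function of $B$. A t-conorm on $I$ is a binary operation $I^2\to I$ that is commutative, associative, increasing (non-decreasing) in each argument, and has neutral element $0$. Given a binary operation $\ast:I^2\to I$ (arbitrary) and a t-conorm $\nabla$ on $I$, the binary operation $\widetilde{\nabla}_{\ast}:\mathbf{M}^2\to\mathbf{M}$ is defined by $$(f\,\widetilde{\nabla}_{\ast}\,g)(x)=\sup\{f(y)\ast g(z)\mid y,z\in I,\ y\nabla z=x\},\qquad f,g\in\mathbf{M},\ x\in I.$$ *)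

(* Defs.v *)
From HB Require Import structures.
From mathcomp Require Import all_boot all_order all_algebra.
From mathcomp Require Import all_classical all_reals all_analysis.

Set Implicit Arguments.
Unset Strict Implicit.
Unset Printing Implicit Defensive.

Import Order.TTheory GRing.Theory Num.Theory.
Import numFieldNormedType.Exports.

Local Open Scope classical_set_scope.
Local Open Scope ring_scope.

(* [{i01 R}] is the type of the elements of [0, 1]; the library orders it as a
   subset of [R] but gives it no topology: we take the subspace topology. *)
HB.instance Definition _ (R : realType) :=
  Topological.copy {i01 R} (initial_topology (fun x : {i01 R} => x%:num)).

Section UnitInterval.
Variable R : realType.
Local Notation I := {i01 R}.

Definition I0 : I := 0%:i01.
Definition I1 : I := 1%:i01.

(* Least upper bound in [0, 1]; the default value [I0] is taken only on the
   empty set, for which it is the least upper bound (see [supI_supremums]). *)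
Definition supI (A : set I) : I := supremum I0 A.

Definition charI (B : set I) : I -> I := fun x => if x \in B then I1 else I0.

Record tconorm (nabla : I -> I -> I) : Prop := {
  tconormC : commutative nabla;
  tconormA : associative nabla;
  tconorm_homol : forall z, {homo nabla^~ z : x y / x <= y};
  tconorm_homor : forall z, {homo nabla z : x y / x <= y};
  tconorm0l : left_id I0 nabla;
  tconorm0r : right_id I0 nabla
}.

Definition convolution (star nabla : I -> I -> I) (f g : I -> I) : I -> I :=
  fun x => supI [set star (f p.1) (g p.2) | p in [set p | nabla p.1 p.2 = x]].

Definition axiom_O5' (op : (I -> I) -> (I -> I) -> (I -> I)) : Prop :=
  forall a b : I, a <= b ->
    op (charI `[I0, I1]) (charI `[a, b]) = charI `[a, I1].

Definition continuous_tconorm (nabla : I -> I -> I) : Prop :=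
  tconorm nabla /\ continuous (fun p : I * I => nabla p.1 p.2).

Lemma I0_le (x : I) : I0 <= x.
Proof. by rewrite -num_le /=. Qed.

Lemma le_I1 (x : I) : x <= I1.
Proof. by rewrite -num_le /=. Qed.

Lemma supI_supremums (A : set I) : supremums A (supI A).
Proof.
rewrite /supI /supremum; case: eqP => [->|/eqP/set0P[x0 Ax0]].
  by split=> [x|x _] //; exact: I0_le.
pose B := [set x%:num | x in A] : set R.
have B1 : ubound B 1 by move=> _ [x _ <-]; have := le_I1 x; rewrite -num_le.
have Bs : has_sup B by split; [exists x0%:num, x0 | exists 1].
have s01 : 0 <= sup B <= 1.
  apply/andP; split; last by apply: ge_sup => //; exists x0%:num, x0.
  apply: (@le_trans _ _ x0%:num); first by have := I0_le x0; rewrite -num_le.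
  by apply: ub_le_sup; [case: Bs | exists x0].
have [/= s0 s1] := andP s01.
have sP : Itv.spec (@Itv.num_sem R) (Itv.Real `[0, 1]%Z) (sup B).
  by apply/and3P; split; rewrite /= ?num_real// in_itv/= s0 s1.
apply: (@xgetPex _ I0); exists (Itv.Def sP); split=> [x Ax|y Ay].
  by rewrite -num_le /=; apply: ub_le_sup; [case: Bs | exists x].
rewrite -num_le /=; apply: ge_sup; first by exists x0%:num, x0.
by move=> _ [x Ax <-]; rewrite num_le; exact: Ay.
Qed.

End UnitInterval.

Arguments I0 {R}.
Arguments I1 {R}.

(* Main.v *)
Require Import Defs.
From HB Require Import structures.
From mathcomp Require Import all_boot all_order all_algebra.
From mathcomp Require Import all_classical all_reals all_analysis.
From mathcomp Require Import lra.
Import Order.TTheory GRing.Theory Num.Theory.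
Import numFieldNormedType.Exports.
Local Open Scope classical_set_scope.
Local Open Scope ring_scope.

(** The axiom concerns only the images of the sections x |-> x nabla b.  As the
    left argument of the convolution is the constant function 1, once
    1 * 0 = 0 and 1 * 1 = 1 the convolution with the characteristic function of
    B is the characteristic function of {y nabla z | z in B}
    ([convolution_charI]).  Since y nabla z >= z, the axiom then says that each
    section x |-> x nabla b takes every value in [b, 1] ([axiom_O5'P]), and
    [b, 1] is the whole interval between its values b at 0 and 1 at 1.  For a
    nondecreasing map of [0, 1], taking every value between those at the end
    points amounts to continuity ([nondecreasing_surj_continuous] in one
    direction, the intermediate value theorem [continuousI_IVT] in the other).

    The two conditions on * come out of the axiom at x = 0: the only pair with
    y nabla z = 0 is (0, 0), so there the convolution has the value 1 * g(0),
    and the intervals [1, 1] and [0, 0] give g(0) = 0 and g(0) = 1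
    ([axiom_O5'_star]).

    Continuity of the sections implies joint continuity because nabla is
    monotone: near (x, y) its values lie between its values at two corners of a
    small rectangle, and the corners are reached by moving one coordinate at a
    time ([nondecreasing_jointly_continuous]). *)

(** * Topology of the unit interval *)

Lemma clamp_ge0 {R : realType} (r : R) : 0 <= Num.max 0 (Num.min 1 r).
Proof. by rewrite le_max lexx. Qed.

Lemma clamp_le1 {R : realType} (r : R) : Num.max 0 (Num.min 1 r) <= 1.
Proof. by rewrite ge_max ler01 ge_min lexx. Qed.

(** The retraction of the real line onto [0, 1], which turns points and maps of
    [0, 1] into real ones and back. *)
Definition clampI {R : realType} (r : R) : {i01 R} :=
  Itv01 (clamp_ge0 r) (clamp_le1 r).

Lemma num_clampI {R : realType} (r : R) : 0 <= r <= 1 -> (clampI r)%:num = r.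
Proof. by case/andP=> r0 r1 /=; rewrite (min_idPr r1) (max_idPr r0). Qed.

Lemma numI_itv {R : realType} (x : {i01 R}) : 0 <= x%:num <= (1 : R).
Proof. by have := I0_le x; have := le_I1 x; rewrite -!num_le /= => -> ->. Qed.

Lemma numI_continuous {R : realType} :
  continuous (fun x : {i01 R} => x%:num : R).
Proof.
exact: (@initial_continuous {i01 R} R (fun x : {i01 R} => x%:num : R)).
Qed.

Lemma near_i01 {R : realType} (x : {i01 R}) (e : R) : 0 < e ->
  \forall y \near x, `|x%:num - y%:num| < e.
Proof. by move=> e0; move/cvgrPdist_lt: (numI_continuous x) => /(_ e e0). Qed.

Lemma continuousI_dist {R : realType} (T : topologicalType) (h : T -> {i01 R}) :
  continuous h <-> forall t (e : R), 0 < e ->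
    \forall s \near t, `|(h t)%:num - (h s)%:num| < e.
Proof.
split=> [hc t e e0|hd].
  by move: (hc t _ (near_i01 (h t) e e0)).
apply: (@continuous_comp_initial {i01 R} T R (fun x : {i01 R} => x%:num : R)).
by move=> t; apply/cvgrPdist_lt => e e0; exact: hd.
Qed.

Lemma clampK {R : realType} (x : {i01 R}) : clampI x%:num = x.
Proof. by apply: val_inj; apply: num_clampI; exact: numI_itv. Qed.

Lemma le_clampI {R : realType} : {homo @clampI R : r s / r <= s}.
Proof.
move=> r s rs; rewrite -num_le /= /Num.max /Num.min.
by case: (ltP 1 r) => ?; case: (ltP 1 s) => ?; do 2?[case: ltP => ?]; lra.
Qed.

Lemma clampI_continuous {R : realType} : continuous (@clampI R).
Proof.
apply: (@continuous_comp_initial {i01 R} R R (fun x : {i01 R} => x%:num : R)).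
move=> r; apply: (@continuous_max R R (fun=> 0) (Num.min 1)).
  exact: cvg_cst.
by apply: (@continuous_min R R (fun=> 1) id); [exact: cvg_cst | exact: cvg_id].
Qed.

(** * Continuity of nondecreasing maps *)

(** A nondecreasing map is controlled near x by its values at two points
    bracketing x, so only these two values have to be estimated.  The brackets
    are neighbourhoods relative to [0, 1], so at x = 0 or x = 1 one end may be x
    itself. *)
Lemma nondecreasing_continuousP {R : realType} (h : {i01 R} -> {i01 R}) :
  {homo h : x y / x <= y} ->
  continuous h <-> forall x (e : R), 0 < e -> exists l u,
    [/\ \forall y \near x, l <= y <= u,
        (h x)%:num - e < (h l)%:num & (h u)%:num < (h x)%:num + e].
Proof.
move=> hmono; split=> [hc x e e0|hb].
  have gc : {for x%:num, continuous (h \o clampI)}.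
    by apply: continuous_comp; [exact: clampI_continuous | exact: hc].
  have := gc _ (near_i01 (h (clampI x%:num)) e e0).
  move=> /= [d /= d0 hd].
  have hdist r : `|x%:num - r| < d ->
      `|(h x)%:num - (h (clampI r))%:num| < e.
    by move=> /hd /=; rewrite clampK.
  exists (clampI (x%:num - d / 2)), (clampI (x%:num + d / 2)); split.
  - have d20 : 0 < d / 2 by lra.
    apply: filterS (near_i01 x _ d20) => y; rewrite ltr_distlC => /andP[? ?].
    by rewrite -{1 2}(clampK y) !le_clampI //; lra.
  - have /hdist : `|x%:num - (x%:num - d / 2)| < d.
      by rewrite ltr_norml; apply/andP; split; lra.
    by rewrite ltr_norml => /andP[_ ?]; lra.
  - have /hdist : `|x%:num - (x%:num + d / 2)| < d.
      by rewrite ltr_norml; apply/andP; split; lra.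
    by rewrite ltr_norml => /andP[? _]; lra.
apply/continuousI_dist => x e e0.
have [l [u [nlu hl hu]]] := hb x e e0.
apply: filterS nlu => y /andP[/hmono + /hmono].
by rewrite -!num_le /= ltr_distlC => ? ?; apply/andP; split; lra.
Qed.

(** A monotone map can only fail to be continuous by a jump, which would leave
    out some intermediate value. *)
Lemma nondecreasing_surj_continuous {R : realType} (h : {i01 R} -> {i01 R}) :
  {homo h : x y / x <= y} ->
  (forall v, h I0 <= v <= h I1 -> exists x, h x = v) -> continuous h.
Proof.
move=> hmono hsurj; apply/nondecreasing_continuousP => // x e e0.
have h0x : (h I0)%:num <= (h x)%:num :> R by rewrite num_le hmono // I0_le.
have hx1 : (h x)%:num <= (h I1)%:num :> R by rewrite num_le hmono // le_I1.
have hit (r : R) : (h I0)%:num <= r <= (h I1)%:num ->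
    exists y, (h y)%:num = r.
  move=> /andP[r0 r1].
  have r01 : 0 <= r <= 1.
    have /andP[? _] := numI_itv (h I0); have /andP[_ ?] := numI_itv (h I1).
    by apply/andP; split; lra.
  have [|y hy] := hsurj (clampI r).
    by rewrite -!num_le num_clampI // r0.
  by exists y; rewrite hy num_clampI.
(* When h x = h 0 the bracket starts at 0; otherwise it starts at a preimage of
   a value just below h x, and such a preimage is below x by monotonicity. *)
have [l [nl hl]] : exists l,
    (\forall y \near x, l <= y) /\ (h x)%:num - e < (h l)%:num.
  have [hx0|h0_lt] := leP (h x)%:num (h I0)%:num.
    by exists I0; split; [exact: (@filterE _ (nbhs x) _ _ (@I0_le R)) | lra].
  have [r [r0 rx re]] :
      exists r, [/\ (h I0)%:num <= r, r < (h x)%:num & (h x)%:num - e < r].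
    have [?|?] := leP (h I0)%:num ((h x)%:num - e / 2).
      by exists ((h x)%:num - e / 2); split; lra.
    by exists (h I0)%:num; split; lra.
  have [|l hl] := hit r; first by apply/andP; split; lra.
  exists l; rewrite hl; split=> //.
  have lx : l%:num < x%:num :> R.
    by rewrite num_lt ltNge; apply/negP => /hmono; rewrite -num_le /= hl; lra.
  have d0 : 0 < x%:num - l%:num :> R by lra.
  apply: filterS (near_i01 x _ d0) => y; rewrite ltr_distlC -num_le /=.
  by move=> /andP[? _]; lra.
have [u [nu hu]] : exists u,
    (\forall y \near x, y <= u) /\ (h u)%:num < (h x)%:num + e.
  have [h1x|lt_h1] := leP (h I1)%:num (h x)%:num.
    by exists I1; split; [exact: (@filterE _ (nbhs x) _ _ (@le_I1 R)) | lra].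
  have [r [r1 xr re]] :
      exists r, [/\ r <= (h I1)%:num, (h x)%:num < r & r < (h x)%:num + e].
    have [?|?] := leP ((h x)%:num + e / 2) (h I1)%:num.
      by exists ((h x)%:num + e / 2); split; lra.
    by exists (h I1)%:num; split; lra.
  have [|u hu] := hit r; first by apply/andP; split; lra.
  exists u; rewrite hu; split=> //.
  have xu : x%:num < u%:num :> R.
    by rewrite num_lt ltNge; apply/negP => /hmono; rewrite -num_le /= hu; lra.
  have d0 : 0 < u%:num - x%:num :> R by lra.
  apply: filterS (near_i01 x _ d0) => y; rewrite ltr_distlC -num_le /=.
  by move=> /andP[_ ?]; lra.
exists l, u; split => //.
by apply: filterS2 nl nu => y -> ->.
Qed.

Lemma continuousI_IVT {R : realType} (h : {i01 R} -> {i01 R}) v :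
  continuous h -> h I0 <= v <= h I1 -> exists x, h x = v.
Proof.
move=> hc /andP[h0v vh1].
have gc : continuous (fun r : R => (h (clampI r))%:num : R).
  move=> r; apply: continuous_comp; last exact: numI_continuous.
  by apply: continuous_comp; [exact: clampI_continuous | exact: hc].
have c0 : clampI 0 = I0 :> {i01 R} by rewrite -(clampK I0).
have c1 : clampI 1 = I1 :> {i01 R} by rewrite -(clampK I1).
have [] := @IVT R _ 0 1 v%:num ler01 (continuous_subspaceT gc).
  rewrite c0 c1 /Num.min /Num.max; move: h0v vh1; rewrite -!num_le /=.
  by case: ltP => ? ? ?; apply/andP; split; lra.
by move=> r _ hr; exists (clampI r); exact: val_inj.
Qed.

(** First bracket x for the section through y, then bracket y for the sections
    through the two ends of the first bracket; each step costs half of e.  By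
    monotonicity the lower and upper corners so obtained bound the operation on
    the whole rectangle. *)
Lemma nondecreasing_jointly_continuous {R : realType}
    (op : {i01 R} -> {i01 R} -> {i01 R}) :
  (forall y, {homo op^~ y : x x' / x <= x'}) ->
  (forall x, {homo op x : y y' / y <= y'}) ->
  (forall y, continuous (op^~ y)) -> (forall x, continuous (op x)) ->
  continuous (fun p : {i01 R} * {i01 R} => op p.1 p.2).
Proof.
move=> homol homor cl cr; apply/continuousI_dist => -[x y] e e0.
have e20 : 0 < e / 2 by lra.
have bl z := (nondecreasing_continuousP _ (homol z)).1 (cl z).
have br z := (nondecreasing_continuousP _ (homor z)).1 (cr z).
have [xl [xu [nx hxl hxu]]] := bl y x _ e20.
have [yl [yl' [nyl hyl _]]] := br xl y _ e20.
have [yu' [yu [nyu _ hyu]]] := br xu y _ e20.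
exists ([set x' | xl <= x' <= xu], [set y' | yl <= y' <= yu]) => /=.
  split=> //=; apply: filterS2 nyl nyu => y'.
  by case/andP => + _ /andP[_ +] /= => -> ->.
move=> [x' y'] /= [/andP[xlx' x'xu] /andP[yly' y'yu]].
have : op xl yl <= op x' y'.
  exact: le_trans (homol _ _ _ xlx') (homor _ _ _ yly').
have : op x' y' <= op xu yu.
  exact: le_trans (homol _ _ _ x'xu) (homor _ _ _ y'yu).
rewrite -!num_le /= ltr_distlC => ? ?; move: hxl hxu hyl hyu => /= *.
by apply/andP; split; lra.
Qed.

(** * The convolution with a t-conorm *)

Lemma tconorm_ge_r {R : realType} (nabla : {i01 R} -> {i01 R} -> {i01 R}) y z :
  tconorm nabla -> z <= nabla y z.
Proof.
move=> tn; rewrite -{1}(tconorm0l tn z); apply: (tconorm_homol tn).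
exact: I0_le.
Qed.

Lemma tconormI1l {R : realType} (nabla : {i01 R} -> {i01 R} -> {i01 R}) z :
  tconorm nabla -> nabla I1 z = I1.
Proof.
move=> tn; apply/le_anti; rewrite le_I1 (tconormC tn) /=.
exact: tconorm_ge_r.
Qed.

Lemma neq_I10 {R : realType} : I1 <> I0 :> {i01 R}.
Proof. by move=> /(congr1 (fun x => x%:num)) /= /eqP; rewrite oner_eq0. Qed.

Lemma supI_max {R : realType} (A : set {i01 R}) m :
  A m -> ubound A m -> supI A = m.
Proof.
move=> Am ub; have [supub suple] := supI_supremums A.
by apply/le_anti; rewrite supub // suple.
Qed.

Lemma supI_eq0 {R : realType} (A : set {i01 R}) :
  (forall v, A v -> v = I0) -> supI A = I0.
Proof.
move=> A0; have [_ suple] := supI_supremums A.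
by apply/le_anti; rewrite I0_le suple // => v /A0 ->.
Qed.

Lemma charI_in {R : realType} (B : set {i01 R}) x : B x -> charI B x = I1.
Proof. by move=> Bx; rewrite /charI mem_set. Qed.

Lemma charI_notin {R : realType} (B : set {i01 R}) x : ~ B x -> charI B x = I0.
Proof. by move=> nBx; rewrite /charI memNset. Qed.

(** All the values over which the supremum is taken are 1 * 1 or 1 * 0, and
    1 * 1 occurs exactly when x = y nabla z for some z in B.  When no pair has
    y nabla z = x the supremum is over the empty set, hence also 0. *)
Lemma convolution_charI {R : realType}
    (star nabla : {i01 R} -> {i01 R} -> {i01 R}) (B : set {i01 R}) :
  star I1 I0 = I0 -> star I1 I1 = I1 ->
  convolution star nabla (charI `[I0, I1]) (charI B) =
  charI [set x | exists y z, B z /\ nabla y z = x].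
Proof.
move=> s10 s11; apply/funext => x.
have charT y : charI `[I0, I1] y = I1 :> {i01 R}.
  by apply: charI_in; rewrite /= in_itv /= I0_le le_I1.
have [[y [z [Bz yzx]]]|nx] := pselect (exists y z, B z /\ nabla y z = x).
  rewrite [RHS]charI_in; last by exists y, z.
  apply: supI_max => [|v _]; last exact: le_I1.
  by exists (y, z) => //=; rewrite charT charI_in.
rewrite [RHS]charI_notin //; apply: supI_eq0 => _ [[y z] /= yzx <-].
by rewrite charT charI_notin // => Bz; apply: nx; exists y, z.
Qed.

(** At 0 the supremum is over the single pair (0, 0), so the axiom for the
    intervals [1, 1] and [0, 0] reads off 1 * 0 and 1 * 1. *)
Lemma axiom_O5'_star {R : realType}
    (star nabla : {i01 R} -> {i01 R} -> {i01 R}) :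
  tconorm nabla -> axiom_O5' (convolution star nabla) ->
  star I1 I0 = I0 /\ star I1 I1 = I1.
Proof.
move=> tn h5.
have conv0 g : convolution star nabla (charI `[I0, I1]) g I0 = star I1 (g I0).
  have -> : star I1 (g I0) = star (charI `[I0, I1] I0) (g I0).
    by rewrite charI_in //= in_itv /= lexx I0_le.
  have fibre p : nabla p.1 p.2 = I0 -> p = (I0, I0).
    case: p => y z /= yz0; congr pair; apply/le_anti; rewrite I0_le andbT -yz0.
      by rewrite (tconormC tn) tconorm_ge_r.
    by rewrite tconorm_ge_r.
  apply: supI_max; first by exists (I0, I0) => //=; exact: (tconorm0l tn).
  by move=> _ [p /fibre -> <-].
split.
  have := congr1 (@^~ I0) (h5 I1 I1 (lexx _)).
  rewrite conv0 !(@charI_notin _ `[I1, I1]) // /= in_itv /= => /andP[+ _].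
  by move=> le10; apply: (@neq_I10 R); apply/le_anti; rewrite le10 I0_le.
have := congr1 (@^~ I0) (h5 I0 I0 (lexx _)).
by rewrite conv0 !charI_in //= in_itv /= lexx ?I0_le.
Qed.

(** The degenerate intervals [b, b] already carry the whole content of the
    axiom.  Conversely the values x >= a are reached with z = a alone, and the
    values below a are excluded by y nabla z >= z >= a. *)
Lemma axiom_O5'P {R : realType}
    (star nabla : {i01 R} -> {i01 R} -> {i01 R}) :
  tconorm nabla -> star I1 I0 = I0 -> star I1 I1 = I1 ->
  axiom_O5' (convolution star nabla) <->
  forall b v, b <= v -> exists y, nabla y b = v.
Proof.
move=> tn s10 s11; split=> [h5 b v bv|surj a b ab].
  have := congr1 (@^~ v) (h5 b b (lexx b)).
  rewrite convolution_charI // [RHS]charI_in; last first.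
    by rewrite /= in_itv /= bv le_I1.
  rewrite /charI; case: ifPn => [|_ /esym/neq_I10 //].
  move=> /set_mem [y [z [/= + <-]]] _.
  by rewrite in_itv /= => /le_anti <-; exists y.
rewrite convolution_charI //; congr charI; apply/seteqP; split=> x /=.
  move=> [y [z [+ <-]]]; rewrite !in_itv /= le_I1 andbT => /andP[az _].
  exact: le_trans az (tconorm_ge_r _ _ _ tn).
rewrite in_itv /= => /andP[ax _]; have [y yax] := surj a x ax.
by exists y, a; rewrite in_itv /= lexx.
Qed.

Theorem theorem12 (R : realType) (star nabla : {i01 R} -> {i01 R} -> {i01 R})
    (nabla_tconorm : tconorm nabla) :
  let P1 := axiom_O5' (convolution star nabla) in
  let P2 := star I1 I0 = I0 /\ star I1 I1 = I1 /\
    (forall b : {i01 R}, continuous (fun x : {i01 R} => nabla x b)) in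
  let P3 := star I1 I0 = I0 /\ star I1 I1 = I1 /\ continuous_tconorm nabla in
  (P1 <-> P2) /\ (P2 <-> P3).
Proof.
have tn := nabla_tconorm; have homol := tconorm_homol tn.
split; split.
- move=> h5; have [s10 s11] := axiom_O5'_star _ _ tn h5.
  split=> //; split=> // b.
  apply: nondecreasing_surj_continuous => [|v]; first exact: homol.
  rewrite (tconorm0l tn) => /andP[bv _].
  exact: ((axiom_O5'P _ _ tn s10 s11).1 h5).
- move=> [s10 [s11 nc]]; apply/(axiom_O5'P _ _ tn s10 s11) => b v bv.
  apply: (@continuousI_IVT _ (nabla^~ b)); first exact: nc.
  by rewrite (tconorm0l tn) (tconormI1l _ _ tn) bv le_I1.
- move=> [s10 [s11 nc]]; split=> //; split=> //; split=> //.
  apply: nondecreasing_jointly_continuous => [|||x].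
  + exact: homol.
  + exact: (tconorm_homor tn).
  + exact: nc.
  + have -> : nabla x = nabla^~ x by apply/funext => y; exact: (tconormC tn).
    exact: nc.
- move=> [s10 [s11 [_ nc]]]; split=> //; split=> // b x.
  have pc : (fun y : {i01 R} => (y, b)) y @[y --> x] --> (x, b).
    apply: (@cvg_pair _ _ _ (nbhs x) (nbhs x) (nbhs b)); first exact: cvg_id.
    exact: cvg_cst.
  exact: cvg_comp pc (nc (x, b)).
Qed.
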